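(* Let $F:\mathbb{R}^N\times\mathbb{R}_{+}\times\mathbb{R}^d\to\mathbb{R}^N$, let $\mathcal D\subset\mathbb{R}^d$, fix $\breve\mu\in\mathcal D$, and let $\Delta t>0$, time instances $t^0<t^1<\dots<t^{n_t}$ with $t^{n+1}=t^n+\Delta t$, and $f(w,t;\mu)=w-\Delta t\,F(w,t;\mu)$. Assume that $f$ satisfies the inverse Lipschitz continuity condition: there is $\varepsilon>0$ such that $$\frac{\|f(w,t^n;\breve\mu)-f(y,t^n;\breve\mu)\|}{\|w-y\|}\ \ge\ \varepsilon\ >\ 0\qquad\text{for all } w\neq y \text{ in } \mathbb{R}^N \text{ and all } n\in\{1,\dots,n_t\}.$$ Let $w^0,w^1,\dots,w^{n_t}\in\mathbb{R}^N$ be the states computed by the high-dimensional model with the backward-Euler scheme for input $\breve\mu$, where the residual $$R^n(w^{n+1};\breve\mu)=w^{n+1}-w^n-\Delta t\,F(w^{n+1},t^{n+1};\breve\mu)$$ satisfies $\|R^n(w^{n+1};\breve\mu)\|\le\epsilon_{\mathrm{Newton}}$ for all $n\in\{0,\dots,n_t-1\}$. Then for any sequence of states $\tilde w^0,\tilde w^1,\dots,\tilde w^{n_t}\in\mathbb{R}^N$ with $\tilde w^0=w^0$, and for every $n\in\{1,\dots,n_t\}$, $$\|w^n-\tilde w^n\|\ \le\ \sum_{k=1}^{n}a^{k}b_{n-k}\ \le\ \sum_{k=1}^{n}a^{k}c_{n-k}\ \le\ \sum_{k=1}^{n}a^{k}d_{n-k},$$ where $$a=\sup_{n\in\{1,\dots,n_t\}}\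 \sup_{w\neq y}\frac{\|w-y\|}{\|f(w,t^n;\breve\mu)-f(y,t^n;\breve\mu)\|},$$ and, for $n\in\{0,\dots,n_t-1\}$, $$b_n=\epsilon_{\mathrm{Newton}}+\|\tilde R^n(\tilde w^{n+1};\breve\mu)\|,$$ $$c_n=\epsilon_{\mathrm{Newton}}+\|P\tilde R^n(\tilde w^{n+1};\breve\mu)\|+\|(I-P)\tilde R^n(\tilde w^{n+1};\breve\mu)\|,$$ $$d_n=\epsilon_{\mathrm{Newton}}+\|P\tilde R^n(\tilde w^{n+1};\breve\mu)\|+\|\mathsf R^{-1}\|\,\|(I-\mathbb P)\tilde R^n(\tilde w^{n+1};\breve\mu)\|,$$ with $\tilde R^n(w;\mu)=w-\tilde w^n-\Delta t\,F(w,t^{n+1};\mu)$, $P=\Phi_R[Z\Phi_R]^{+}Z$, $\mathbb P=\Phi_R\Phi_R^T$, and $Z\Phi_R=\mathsf Q\mathsf R$ the thin QR factorization with $\mathsf Q\in\mathbb{R}^{n_i\times n_R}$ and $\mathsf R\in\mathbb{R}^{n_R\times n_R}$.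
   Context: $\|\cdot\|$ is the Euclidean norm for vectors and the induced (spectral) norm for matrices. The function $F$ is the right-hand side of the semi-discretized parameterized ODE $\frac{dw}{dt}=F(w(t),t;\mu)$, $w(0)=w^0(\mu)$, and $\mathcal D$ is the input-parameter domain. $\Phi_R\in\mathbb{R}^{N\times n_R}$, with $n_R\ge 1$, is a POD basis matrix, so it has orthonormal columns: $\Phi_R^T\Phi_R=I$. The matrix $Z\in\mathbb{R}^{n_i\times N}$ is a sample matrix: its rows are the transposes $e_{\mathsf i_1}^T,\dots,e_{\mathsf i_{n_i}}^T$ of canonical unit vectors of $\mathbb{R}^N$ for a set of $n_i$ distinct sample indices $\{\mathsf i_1,\dots,\mathsf i_{n_i}\}\subset\{1,\dots,N\}$, with $n_i\ge n_R$. It is assumed that $Z\Phi_R$ has full column rank, so that $\mathsf R$ is invertible. The superscript $+$ denotes the Moore–Penrose pseudo-inverse. In the thin QR factorization, $\mathsf Q$ has orthonormal columns and $\mathsf R$ is upper triangular. *)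

(* Defs.v *)
From HB Require Import structures.
From mathcomp Require Import all_boot all_order all_algebra.
From mathcomp Require Import boolp classical_sets reals interval_inference.

Set Implicit Arguments.
Unset Strict Implicit.
Unset Printing Implicit Defensive.

Import Order.TTheory GRing.Theory Num.Theory.
Local Open Scope classical_set_scope.
Local Open Scope ring_scope.

(* The norm that MathComp-Analysis puts on matrices is the max norm, hence the
   separate Euclidean and spectral norms. *)
Definition enorm (R : realType) (n : nat) (x : 'cV[R]_n) : R :=
  Num.sqrt (\sum_(i < n) x i 0 ^+ 2).

Definition spectral_norm (R : realType) (m n : nat) (A : 'M[R]_(m, n)) : R :=
  sup [set enorm (A *m x) | x in [set x : 'cV[R]_n | enorm x <= 1]].

Definition sample_matrix (R : realType) (m n : nat) (Z : 'M[R]_(m, n)) : Prop :=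
  exists2 s : 'I_m -> 'I_n,
    injective s & forall i : 'I_m, row i Z = delta_mx 0 (s i).

Definition moore_penrose (R : realType) (m n : nat)
    (A : 'M[R]_(m, n)) (B : 'M[R]_(n, m)) : Prop :=
  [/\ A *m B *m A = A, B *m A *m B = B,
      (A *m B)^T = A *m B & (B *m A)^T = B *m A].

(* pinvmx of mxalgebra is only a partial inverse on the row space, not the
   Moore-Penrose one. The default 0 below is never used, by mp_invP. *)
Definition mp_inv (R : realType) (m n : nat) (A : 'M[R]_(m, n)) : 'M[R]_(n, m) :=
  xget 0 [set B | moore_penrose A B].

Lemma gram_unitmx (R : realType) (m n : nat) (A : 'M[R]_(m, n)) :
  row_free A -> A *m A^T \in unitmx.
Proof.
move=> Afree; rewrite -row_free_unit -kermx_eq0; apply/eqP/row_matrixP => i.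
rewrite row0; set u := row i _.
have uAA : u *m (A *m A^T) = 0 by apply/sub_kermxP; exact: row_sub.
have uA2 : (u *m A) *m (u *m A)^T = 0
  by rewrite trmx_mul mulmxA -(mulmxA u) uAA mul0mx.
have uA : u *m A = 0.
  move: (u *m A) uA2 => v /matrixP/(_ 0 0); rewrite mxE [RHS]mxE => /eqP.
  rewrite psumr_eq0 => [/allP v0|j _]; last by rewrite mxE -expr2 sqr_ge0.
  apply/rowP => j; have := v0 j (mem_index_enum _).
  by rewrite mxE mulf_eq0 orbb => /eqP ->; rewrite mxE.
by apply: (row_free_inj Afree); rewrite uA mul0mx.
Qed.

Lemma moore_penrose_exists (R : realType) (m n : nat) (A : 'M[R]_(m, n)) :
  exists B, moore_penrose A B.
Proof.
move: (row_base_free A) (col_base_full A) (mulmx_base A).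
move: (col_base A) (row_base A) => C F Ffree Cfull AE.
have FU : F *m F^T \in unitmx by exact: gram_unitmx.
have CU : C^T *m C \in unitmx.
  by rewrite -{2}[C]trmxK; apply: gram_unitmx; rewrite /row_free mxrank_tr.
pose Fi := F^T *m invmx (F *m F^T); pose Ci := invmx (C^T *m C) *m C^T.
have FFi : F *m Fi = 1%:M by rewrite mulmxA mulmxV.
have CiC : Ci *m C = 1%:M by rewrite -mulmxA mulVmx.
have AB : C *m F *m (Fi *m Ci) = C *m Ci.
  by rewrite mulmxA -(mulmxA C) FFi mulmx1.
have BA : Fi *m Ci *m (C *m F) = Fi *m F.
  by rewrite mulmxA -(mulmxA Fi) CiC mulmx1.
exists (Fi *m Ci); suff: moore_penrose (C *m F) (Fi *m Ci) by rewrite AE.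
split.
- by rewrite AB -mulmxA (mulmxA Ci) CiC mul1mx.
- by rewrite BA -mulmxA (mulmxA F) FFi mul1mx.
- by rewrite AB /Ci !trmx_mul trmx_inv trmx_mul !trmxK mulmxA.
- by rewrite BA /Fi !trmx_mul trmx_inv trmx_mul !trmxK -mulmxA.
Qed.

Lemma mp_invP (R : realType) (m n : nat) (A : 'M[R]_(m, n)) :
  moore_penrose A (mp_inv A).
Proof.
have [B AB] := moore_penrose_exists A.
by rewrite /mp_inv; case: xgetP => [C _ //|/(_ B)]; case.
Qed.

Lemma moore_penrose_uniq (R : realType) (m n : nat) (A : 'M[R]_(m, n)) B C :
  moore_penrose A B -> moore_penrose A C -> B = C.
Proof.
move=> [b1 b2 b3 b4] [c1 c2 c3 c4].
have AE : A *m B = A *m C.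
  by rewrite -{1}c1 -mulmxA -c3 -b3 -trmx_mul mulmxA b1.
have EA : B *m A = C *m A.
  by rewrite -{1}c1 -(mulmxA A) mulmxA -b4 -c4 -trmx_mul -mulmxA (mulmxA A) b1.
by rewrite -b2 EA -mulmxA AE mulmxA c2.
Qed.

Section BackwardEuler.
Variables (R : realType) (N d : nat).
Variable F : 'cV[R]_N -> {nonneg R} -> 'cV[R]_d -> 'cV[R]_N.
Variable dt : R.

Definition be_map (w : 'cV[R]_N) (s : {nonneg R}) (mu : 'cV[R]_d) : 'cV[R]_N :=
  w - dt *: F w s mu.

Definition be_residual (t : nat -> {nonneg R}) (u : nat -> 'cV[R]_N) (n : nat)
    (v : 'cV[R]_N) (mu : 'cV[R]_d) : 'cV[R]_N :=
  v - u n - dt *: F v (t n.+1) mu.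

(* sup is 0 on sets that are not bounded above and x / 0 = 0; an inverse
   Lipschitz bound for be_map rules both out. *)
Definition inv_lipschitz_const (t : nat -> {nonneg R}) (nt : nat)
    (mu : 'cV[R]_d) : R :=
  sup [set sup [set enorm (p.1 - p.2) /
                    enorm (be_map p.1 (t n) mu - be_map p.2 (t n) mu)
               | p in [set p : 'cV[R]_N * 'cV[R]_N | p.1 <> p.2]]
      | n in [set n : nat | (1 <= n <= nt)%N]].

End BackwardEuler.

(* Main.v *)
Require Import Defs.
From HB Require Import structures.
From mathcomp Require Import all_boot all_order all_algebra.
From mathcomp Require Import boolp classical_sets reals interval_inference.
From mathcomp Require Import ring lra.

Import Order.TTheory GRing.Theory Num.Theory.
Local Open Scope classical_set_scope.
Local Open Scope ring_scope.

(** The error bounds have two independent sources.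

    Time stepping.  Written with f = [be_map F dt], one backward-Euler step
    reads f(w^{n+1}) = w^n + R^n, and likewise for the approximate states.
    Subtracting the two steps, the inverse Lipschitz bound gives
    |w^{n+1} - wt^{n+1}| <= a (|w^n - wt^n| + b_n)
    ([inv_lipschitz_constP]), and unrolling this recurrence gives the first
    inequality ([geometric_gronwall]).  Since a >= 0, the two other
    inequalities reduce to b_n <= c_n <= d_n, where b_n <= c_n is the
    triangle inequality.

    The oblique projector.  As Z Phi = Q R has full column rank, its
    Moore-Penrose inverse is R^-1 Q^T, so P = Phi R^-1 Q^T Z is a projector
    onto the range of Phi.  The factors Phi, Q^T and Z do not increase the
    Euclidean norm, so |P z| <= |R^-1| |z| for all z.  Moreover I - P
    vanishes on the range of Phi, whence (I - P) r = (I - P) (I - PP) r.  The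
    inequality c_n <= d_n is then an instance of the classical fact that a
    projector P other than 0 and I satisfies |I - P| = |P|; it is used in the
    pointwise form of [norm_compl_projector], for vectors orthogonal to their
    image under P, which also covers P = I. *)

(** * Euclidean geometry of column vectors *)

Definition edot {R : realType} {n : nat} (x y : 'cV[R]_n) : R :=
  (x^T *m y) 0 0.

Lemma edotDl {R : realType} {n : nat} (x y z : 'cV[R]_n) :
  edot (x + y) z = edot x z + edot y z.
Proof. by rewrite /edot linearD /= mulmxDl mxE. Qed.

Lemma edotZl {R : realType} {n : nat} (k : R) (x y : 'cV[R]_n) :
  edot (k *: x) y = k * edot x y.
Proof. by rewrite /edot linearZ /= -scalemxAl mxE. Qed.

Lemma edotC {R : realType} {n : nat} (x y : 'cV[R]_n) : edot x y = edot y x.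
Proof. by rewrite /edot -[y^T *m x]trmxK [RHS]mxE trmx_mul trmxK. Qed.

Lemma edotDr {R : realType} {n : nat} (x y z : 'cV[R]_n) :
  edot x (y + z) = edot x y + edot x z.
Proof. by rewrite edotC edotDl !(edotC x). Qed.

Lemma edotZr {R : realType} {n : nat} (k : R) (x y : 'cV[R]_n) :
  edot x (k *: y) = k * edot x y.
Proof. by rewrite edotC edotZl edotC. Qed.

Lemma edot_mulmxl {R : realType} {m n : nat} (A : 'M[R]_(m, n)) x y :
  edot (A *m x) y = edot x (A^T *m y).
Proof. by rewrite /edot trmx_mul mulmxA. Qed.

Lemma edotxx {R : realType} {n : nat} (x : 'cV[R]_n) :
  edot x x = \sum_(i < n) x i 0 ^+ 2.
Proof. by rewrite /edot mxE; apply: eq_bigr => i _; rewrite mxE expr2. Qed.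

Lemma edot_ge0 {R : realType} {n : nat} (x : 'cV[R]_n) : 0 <= edot x x.
Proof. by rewrite edotxx sumr_ge0 // => i _; rewrite sqr_ge0. Qed.

Lemma edot_eq0 {R : realType} {n : nat} (x : 'cV[R]_n) :
  (edot x x == 0) = (x == 0).
Proof.
apply/idP/eqP => [|->]; last by rewrite /edot mulmx0 mxE.
rewrite edotxx psumr_eq0 => [/allP x0|i _]; last exact: sqr_ge0.
apply/colP => i; have := x0 i (mem_index_enum _).
by rewrite sqrf_eq0 mxE => /eqP.
Qed.

Lemma enormE {R : realType} {n : nat} (x : 'cV[R]_n) :
  enorm x = Num.sqrt (edot x x).
Proof. by rewrite edotxx. Qed.

Lemma enorm_ge0 {R : realType} {n : nat} (x : 'cV[R]_n) : 0 <= enorm x.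
Proof. exact: sqrtr_ge0. Qed.

Lemma sqr_enorm {R : realType} {n : nat} (x : 'cV[R]_n) :
  enorm x ^+ 2 = edot x x.
Proof. by rewrite enormE sqr_sqrtr // edot_ge0. Qed.

Lemma enorm_eq0 {R : realType} {n : nat} (x : 'cV[R]_n) :
  (enorm x == 0) = (x == 0).
Proof. by rewrite -edot_eq0 -sqr_enorm sqrf_eq0. Qed.

Lemma enorm0 {R : realType} {n : nat} : enorm (0 : 'cV[R]_n) = 0.
Proof. by apply/eqP; rewrite enorm_eq0. Qed.

Lemma enorm_gt0 {R : realType} {n : nat} (x : 'cV[R]_n) :
  (0 < enorm x) = (x != 0).
Proof. by rewrite lt_neqAle enorm_ge0 andbT eq_sym enorm_eq0. Qed.

Lemma enormZ {R : realType} {n : nat} (k : R) (x : 'cV[R]_n) :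
  enorm (k *: x) = `|k| * enorm x.
Proof.
by rewrite !enormE edotZl edotZr mulrA -expr2 sqrtrM ?sqr_ge0 // sqrtr_sqr.
Qed.

Lemma ler_enorm {R : realType} {m n : nat} (x : 'cV[R]_m) (y : 'cV[R]_n) :
  (enorm x <= enorm y) = (edot x x <= edot y y).
Proof. by rewrite !enormE ler_sqrt // edot_ge0. Qed.

Lemma cauchy_schwarz {R : realType} {n : nat} (x y : 'cV[R]_n) :
  edot x y <= enorm x * enorm y.
Proof.
have [->|y0] := eqVneq y 0.
  by rewrite enorm0 mulr0 /edot mulmx0 mxE.
have yy : 0 < edot y y by rewrite -sqr_enorm exprn_gt0 // enorm_gt0.
apply: le_trans (ler_norm _) _.
rewrite -(@ler_sqr _ `|_|) ?nnegrE ?mulr_ge0 ?enorm_ge0 //.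
rewrite real_normK ?num_real // exprMn !sqr_enorm.
(* The residual of the projection of x on y, scaled by |y|^2 to avoid a
   division, has nonnegative squared norm. *)
have := edot_ge0 (edot y y *: x + (- edot x y) *: y).
rewrite !(edotDl, edotDr, edotZl, edotZr) (edotC y x).
rewrite [X in 0 <= X](_ : _ =
  edot y y * (edot x x * edot y y - edot x y ^+ 2)); last by ring.
by rewrite pmulr_rge0 // subr_ge0.
Qed.

Lemma ler_enormD {R : realType} {n : nat} (x y : 'cV[R]_n) :
  enorm (x + y) <= enorm x + enorm y.
Proof.
rewrite -ler_sqr ?nnegrE ?addr_ge0 ?enorm_ge0 // sqrrD !sqr_enorm.
rewrite !(edotDl, edotDr) (edotC y x).
by have := cauchy_schwarz x y; lra.
Qed.

Lemma enormN {R : realType} {n : nat} (x : 'cV[R]_n) : enorm (- x) = enorm x.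
Proof. by rewrite -scaleN1r enormZ normrN1 mul1r. Qed.

Lemma ler_enormB {R : realType} {n : nat} (x y : 'cV[R]_n) :
  enorm (x - y) <= enorm x + enorm y.
Proof. by rewrite -(enormN y) ler_enormD. Qed.

(** * Norms of matrices *)

Lemma enorm_isometry {R : realType} {m n : nat} (A : 'M[R]_(m, n)) x :
  A^T *m A = 1%:M -> enorm (A *m x) = enorm x.
Proof. by move=> AA; rewrite !enormE edot_mulmxl mulmxA AA mul1mx. Qed.

(** Bessel's inequality: A A^T is the orthogonal projector onto the range of
    A, so that |x|^2 - |A^T x|^2 is the squared norm of x - A A^T x. *)
Lemma enorm_trmx_isometry {R : realType} {m n : nat} (A : 'M[R]_(m, n)) x :
  A^T *m A = 1%:M -> enorm (A^T *m x) <= enorm x.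
Proof.
move=> AA; rewrite ler_enorm.
have := edot_ge0 (x + (-1) *: (A *m (A^T *m x))).
rewrite !(edotDl, edotDr, edotZl, edotZr) (edotC x) !edot_mulmxl.
rewrite [A^T *m (A *m _)]mulmxA AA mul1mx.
by lra.
Qed.

Lemma sample_matrix_mulmx_tr {R : realType} {m n : nat} (Z : 'M[R]_(m, n)) :
  sample_matrix Z -> Z *m Z^T = 1%:M.
Proof.
case=> s s_inj Zs; apply/matrixP => i j; rewrite !mxE.
have ZE k l : Z k l = (l == s k)%:R.
  by have /rowP/(_ l) := Zs k; rewrite !mxE eqxx.
rewrite (bigD1 (s i)) //= big1 => [|l /negbTE li].
  by rewrite mxE !ZE eqxx mul1r addr0 (inj_eq s_inj).
by rewrite ZE li mul0r.
Qed.

(** The crude estimate |(A x)_i| <= sum_j |A_ij| for |x| <= 1 is enough here: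
    it makes the supremum defining the spectral norm a genuine one. *)
Lemma has_ubound_spectral {R : realType} {m n : nat} (A : 'M[R]_(m, n)) :
  has_ubound [set enorm (A *m x) | x in [set x : 'cV[R]_n | enorm x <= 1]].
Proof.
exists (Num.sqrt (\sum_(i < m) (\sum_(j < n) `|A i j|) ^+ 2)) => _ [x /= x1 <-].
rewrite /enorm ler_wsqrtr // ler_sum // => i _.
rewrite -real_normK ?num_real // lerXn2r ?nnegrE ?sumr_ge0 //.
rewrite mxE (le_trans (ler_norm_sum _ _ _)) // ler_sum // => j _.
rewrite normrM ler_piMr // -(@ler_pXn2r _ 2) ?nnegrE //.
rewrite real_normK ?num_real // expr1n.
apply: (@le_trans _ _ (enorm x ^+ 2)).
  rewrite sqr_enorm edotxx (bigD1 j) //= lerDl sumr_ge0 // => k _.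
  exact: sqr_ge0.
by rewrite expr_le1 // enorm_ge0.
Qed.

Lemma spectral_normP {R : realType} {m n : nat} (A : 'M[R]_(m, n)) x :
  enorm (A *m x) <= spectral_norm A * enorm x.
Proof.
have [->|x0] := eqVneq x 0; first by rewrite mulmx0 !enorm0 mulr0.
have nx : 0 < enorm x by rewrite enorm_gt0.
rewrite -ler_pdivrMr //.
have nV k : enorm ((enorm x)^-1 *: k : 'cV[R]__) = enorm k / enorm x.
  by rewrite enormZ ger0_norm ?invr_ge0 ?enorm_ge0 // mulrC.
apply: (ub_le_sup (has_ubound_spectral A)).
exists ((enorm x)^-1 *: x); last by rewrite -scalemxAr nV.
by rewrite /= nV divff ?gt_eqF.
Qed.

(** * Projectors *)

(** Let u = P v, which is orthogonal to v.  In the plane spanned by u and v,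
    the projector P is tested on z = |u|^2 v + |v|^2 u, the vector for which
    |P z| / |z| = |v - u| / |v|: by orthogonality
    |P z|^2 = (|u|^2 + |v|^2)^2 |u|^2, |z|^2 = |u|^2 |v|^2 (|u|^2 + |v|^2)
    and |v - u|^2 = |u|^2 + |v|^2.  When u = 0 the vector z degenerates, but
    then v - u = v and it suffices that s >= 1, as holds for any bound of a
    nonzero projector. *)
Lemma norm_compl_projector {R : realType} {n : nat} (P : 'M[R]_n) (s : R) v :
  P *m P = P -> P != 0 -> (forall z, enorm (P *m z) <= s * enorm z) ->
  edot (P *m v) v = 0 ->
  enorm ((1%:M - P) *m v) <= s * enorm v.
Proof.
move=> PP P0 Ps uv0.
have s1 : 1 <= s.
  have [j Pj] : exists j, col j P != 0.
    apply/existsP; apply: contraNT P0 => /existsPn Pj.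
    by apply/eqP/matrixP => i j; have := Pj j; rewrite negbK => /eqP/colP/(_ i);
       rewrite !mxE.
  have := Ps (col j P); rewrite {1}colE mulmxA PP -colE.
  by rewrite -[X in X <= _]mul1r ler_pM2r // enorm_gt0.
have s0 : 0 <= s by lra.
set u := P *m v in uv0 *.
have Pu : P *m u = u by rewrite mulmxA PP.
rewrite mulmxBl mul1mx -/u.
have [->|u0] := eqVneq u 0.
  by rewrite subr0 ler_peMl ?enorm_ge0.
have uu : 0 < edot u u by rewrite -sqr_enorm exprn_gt0 // enorm_gt0.
have vv := edot_ge0 v.
have sqr_le x y : (enorm x <= s * enorm y) = (edot x x <= s ^+ 2 * edot y y).
  rewrite -ler_sqr ?nnegrE ?mulr_ge0 ?enorm_ge0 // exprMn.
  by rewrite !sqr_enorm.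
have := Ps (edot u u *: v + edot v v *: u); rewrite !sqr_le.
rewrite mulmxDr -!scalemxAr -/u Pu -scaleN1r.
rewrite !(edotDl, edotDr, edotZl, edotZr) (edotC v u) uv0.
set B := edot u u in uu *; set A := edot v v in vv *.
have AB : 0 < B * (A + B) by rewrite mulr_gt0 // ltr_wpDl.
move=> Pz; rewrite -(ler_pM2r AB).
by apply: le_trans (le_trans Pz _); rewrite le_eqVlt; apply/orP; left;
  apply/eqP; ring.
Qed.

(** T^-1 Q^T is a left inverse of Q T, and its product with Q T in the other
    order is the symmetric matrix Q Q^T. *)
Lemma mp_inv_qr {R : realType} {m n : nat} (Q : 'M[R]_(m, n)) (T : 'M[R]_n) :
  Q^T *m Q = 1%:M -> T \in unitmx -> mp_inv (Q *m T) = invmx T *m Q^T.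
Proof.
move=> QQ Tu; apply: (moore_penrose_uniq (mp_invP _)).
have AB : Q *m T *m (invmx T *m Q^T) = Q *m Q^T by rewrite mulmxA mulmxK.
have BA : invmx T *m Q^T *m (Q *m T) = 1%:M.
  by rewrite -mulmxA (mulmxA Q^T) QQ mul1mx mulVmx.
split.
- by rewrite -mulmxA BA mulmx1.
- by rewrite BA mul1mx.
- by rewrite AB trmx_mul trmxK.
- by rewrite BA trmx1.
Qed.

(** * Error propagation in time *)

Lemma geometric_gronwall {R : realType} (a : R) (e b : nat -> R) (m : nat) :
  0 <= a -> e 0%N <= 0 ->
  (forall n, (n < m)%N -> e n.+1 <= a * (e n + b n)) ->
  forall n, (n <= m)%N ->
    e n <= \sum_(1 <= k < n.+1) a ^+ k * b (n - k)%N.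
Proof.
move=> a0 e0 eS; elim=> [|n IHn] nm; first by rewrite big_geq.
apply: le_trans (eS n nm) _.
rewrite big_ltn // big_add1 /= expr1 subn1 /= mulrDr addrC lerD2l.
apply: le_trans (ler_wpM2l a0 (IHn (ltnW nm))) _.
by rewrite big_distrr /= ler_sum // => k _; rewrite exprS mulrA subSS.
Qed.

Lemma sup_ge0 {R : realType} (A : set R) :
  (forall x, A x -> 0 <= x) -> 0 <= sup A.
Proof.
move=> A0; have [[[x Ax] Aub]|/sup_out ->//] := pselect (has_sup A).
exact: le_trans (A0 x Ax) (ub_le_sup Aub Ax).
Qed.

Lemma inv_lipschitz_const_ge0 {R : realType} {N d : nat}
  (F : 'cV[R]_N -> {nonneg R} -> 'cV[R]_d -> 'cV[R]_N) dt t nt mu :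
  0 <= inv_lipschitz_const F dt t nt mu.
Proof.
apply: sup_ge0 => _ [n _ <-]; apply: sup_ge0 => _ [p _ <-].
by rewrite divr_ge0 ?enorm_ge0.
Qed.

(** The inverse Lipschitz hypothesis bounds all the quotients by 1 / eps, so
    both suprema are least upper bounds and dominate each quotient; it also
    makes the denominators nonzero. *)
Lemma inv_lipschitz_constP {R : realType} {N d : nat}
  (F : 'cV[R]_N -> {nonneg R} -> 'cV[R]_d -> 'cV[R]_N) dt t nt mu (eps : R) :
  0 < eps ->
  (forall (n : nat) (w y : 'cV[R]_N), (1 <= n <= nt)%N -> w <> y ->
     eps <= enorm (be_map F dt w (t n) mu - be_map F dt y (t n) mu)
              / enorm (w - y)) ->
  forall n (w y : 'cV[R]_N), (1 <= n <= nt)%N ->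
  enorm (w - y) <= inv_lipschitz_const F dt t nt mu *
    enorm (be_map F dt w (t n) mu - be_map F dt y (t n) mu).
Proof.
move=> eps0 hf n w y hn.
have [->|/eqP wy] := eqVneq w y.
  by rewrite !subrr !enorm0 mulr0.
have df m (x z : 'cV[R]_N) : (1 <= m <= nt)%N -> x <> z ->
    0 < enorm (x - z) /\
    eps * enorm (x - z)
      <= enorm (be_map F dt x (t m) mu - be_map F dt z (t m) mu).
  move=> hm xz.
  have xz0 : 0 < enorm (x - z) by rewrite enorm_gt0 subr_eq0; apply/eqP.
  by split=> //; rewrite -ler_pdivlMr //; exact: hf.
have quot_le m : (1 <= m <= nt)%N -> ubound
    [set enorm (p.1 - p.2) /
         enorm (be_map F dt p.1 (t m) mu - be_map F dt p.2 (t m) mu)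
    | p in [set p : 'cV[R]_N * 'cV[R]_N | p.1 <> p.2]] eps^-1.
  move=> hm _ [[x z] /= xz <-]; have [xz0 le_df] := df m x z hm xz.
  rewrite ler_pdivrMr; last by apply: lt_le_trans le_df; exact: mulr_gt0.
  by rewrite mulrC ler_pdivlMr // mulrC.
have [wy0 le_df] := df n w y hn wy.
rewrite -ler_pdivrMr; last by apply: lt_le_trans le_df; exact: mulr_gt0.
apply: (@le_trans _ _ (sup [set enorm (p.1 - p.2) /
    enorm (be_map F dt p.1 (t n) mu - be_map F dt p.2 (t n) mu)
    | p in [set p : 'cV[R]_N * 'cV[R]_N | p.1 <> p.2]])).
  by apply: ub_le_sup; [exists eps^-1; exact: quot_le | exists (w, y)].
apply: ub_le_sup; last by exists n.
exists eps^-1 => _ [m /= hm <-].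
by apply: ge_sup (quot_le m hm); eexists; exists (w, y).
Qed.

(** * The error bounds *)

Theorem proposition4p1 (R : realType) (N d nR ni nt : nat)
  (F : 'cV[R]_N -> {nonneg R} -> 'cV[R]_d -> 'cV[R]_N)
  (D : set 'cV[R]_d) (mu : 'cV[R]_d) (hmu : D mu)
  (dt : R) (hdt : 0 < dt)
  (t : nat -> {nonneg R})
  (ht_lt : forall n : nat, (n < nt)%N -> (t n)%:num < (t n.+1)%:num)
  (ht : forall n : nat, (n < nt)%N -> (t n.+1)%:num = (t n)%:num + dt)
  (hf : exists2 eps : R, 0 < eps &
     forall (n : nat) (w y : 'cV[R]_N), (1 <= n <= nt)%N -> w <> y ->
       eps <= enorm (be_map F dt w (t n) mu - be_map F dt y (t n) mu)
                / enorm (w - y))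
  (Phi : 'M[R]_(N, nR)) (hnR : (1 <= nR)%N) (hPhi : Phi^T *m Phi = 1%:M)
  (Z : 'M[R]_(ni, N)) (hni : (nR <= ni)%N) (hZ : sample_matrix Z)
  (hrank : \rank (Z *m Phi) = nR)
  (Qf : 'M[R]_(ni, nR)) (Rf : 'M[R]_nR)
  (hQR : Z *m Phi = Qf *m Rf) (hQ : Qf^T *m Qf = 1%:M)
  (hR : forall i j : 'I_nR, (j < i)%N -> Rf i j = 0)
  (epsN : R) (w : nat -> 'cV[R]_N)
  (hw : forall n : nat, (n < nt)%N ->
     enorm (be_residual F dt t w n (w n.+1) mu) <= epsN)
  (wt : nat -> 'cV[R]_N) (hwt : wt 0%N = w 0%N) :
  let P : 'M[R]_N := Phi *m mp_inv (Z *m Phi) *m Z in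
  let PP : 'M[R]_N := Phi *m Phi^T in
  let rt (n : nat) : 'cV[R]_N := be_residual F dt t wt n (wt n.+1) mu in
  let a : R := inv_lipschitz_const F dt t nt mu in
  let b (n : nat) : R := epsN + enorm (rt n) in
  let c (n : nat) : R :=
    epsN + enorm (P *m rt n) + enorm ((1%:M - P) *m rt n) in
  let d' (n : nat) : R :=
    epsN + enorm (P *m rt n)
      + spectral_norm (invmx Rf) * enorm ((1%:M - PP) *m rt n) in
  forall n : nat, (1 <= n <= nt)%N ->
    [/\ enorm (w n - wt n) <= \sum_(1 <= k < n.+1) a ^+ k * b (n - k)%N,
        \sum_(1 <= k < n.+1) a ^+ k * b (n - k)%N
          <= \sum_(1 <= k < n.+1) a ^+ k * c (n - k)%N
      & \sum_(1 <= k < n.+1) a ^+ k * c (n - k)%N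
          <= \sum_(1 <= k < n.+1) a ^+ k * d' (n - k)%N].
Proof.
move=> P PP rt a b c d' n /andP[n1 nnt].
have a0 : 0 <= a by exact: inv_lipschitz_const_ge0.
have Ru : Rf \in unitmx.
  rewrite -row_free_unit /row_free eqn_leq rank_leq_row /= -{1}hrank hQR.
  exact: mxrankM_maxr.
have PE : P = Phi *m (invmx Rf *m (Qf^T *m Z)).
  by rewrite /P hQR mp_inv_qr // !mulmxA.
have PPhi : P *m Phi = Phi.
  by rewrite PE -!mulmxA hQR (mulmxA Qf^T) hQ mul1mx mulVmx // mulmx1.
have Pidem : P *m P = P by rewrite {2 3}PE mulmxA PPhi.
have P0 : P != 0.
  apply: contraTneq hnR => P0; rewrite -leqNgt.
  have := mxrank1 R nR; rewrite -hPhi -PPhi P0 mul0mx mulmx0 mxrank0.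
  by move<-.
have Pbound z : enorm (P *m z) <= spectral_norm (invmx Rf) * enorm z.
  rewrite PE -!mulmxA enorm_isometry //.
  apply: le_trans (spectral_normP _ _) _; rewrite ler_wpM2l //.
    by apply: sup_ge0 => _ [x _ <-]; exact: enorm_ge0.
  apply: le_trans (enorm_trmx_isometry Qf _ hQ) _.
  rewrite -{1}[Z]trmxK; apply: (enorm_trmx_isometry Z^T).
  by rewrite trmxK; exact: sample_matrix_mulmx_tr.
have le_bc k : b k <= c k.
  rewrite /b /c -addrA lerD2l; apply: le_trans (ler_enormD _ _).
  by rewrite mulmxBl mul1mx addrC subrK.
have le_cd k : c k <= d' k.
  rewrite /c /d' lerD2l.
  have -> : (1%:M - P) *m rt k = (1%:M - P) *m ((1%:M - PP) *m rt k).
    rewrite [in RHS]mulmxA; congr (_ *m _).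
    by rewrite mulmxBr mulmx1 /PP mulmxA mulmxBl mul1mx PPhi subrr mul0mx subr0.
  apply: norm_compl_projector => //.
  have PhiPP : Phi^T *m (1%:M - PP) = 0.
    by rewrite /PP mulmxBr mulmx1 mulmxA hPhi mul1mx subrr.
  rewrite {1}PE -mulmxA edot_mulmxl [Phi^T *m _]mulmxA PhiPP mul0mx.
  by rewrite /edot mulmx0 mxE.
split.
- apply: (geometric_gronwall a (fun k => enorm (w k - wt k)) b nt) => //.
    by rewrite hwt subrr enorm0.
  move=> k knt; case: hf => eps eps0 hf.
  apply: le_trans (inv_lipschitz_constP F dt t nt mu eps eps0 hf k.+1 _ _ _) _.
    by rewrite /= knt.
  rewrite ler_wpM2l //.
  have -> : be_map F dt (w k.+1) (t k.+1) mu - be_map F dt (wt k.+1) (t k.+1) mu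
      = (w k - wt k) + (be_residual F dt t w k (w k.+1) mu - rt k).
    by rewrite /be_map /rt /be_residual; apply/colP => i; rewrite !mxE; ring.
  apply: le_trans (ler_enormD _ _) _; rewrite lerD2l.
  by apply: le_trans (ler_enormB _ _) _; rewrite lerD2r hw.
- by apply: ler_sum => k _; rewrite ler_wpM2l ?exprn_ge0.
- by apply: ler_sum => k _; rewrite ler_wpM2l ?exprn_ge0.
Qed.
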